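(* Let $S\subset\mathbb{F}[x_1,\dots,x_{3q}]$ be a standard-form system consisting of $q\ge1$ quadratic equations and $\lambda$ linear equations $f_1=0,\dots,f_\lambda=0$, with variables ordered so that the $i$-th quadratic equation is $x_{3i-2}x_{3i-1}+x_{3i}=0$, and let $K=\langle S\rangle$. Let $(H,s,t)$, $W$ and $\tau$ be as constructed from $S$ in the context. Then $W$ is the set of witnesses of the MLD instance $(H,s,t)$, i.e. $W$ is the set of all $v\in\mathbb{F}^{10q}$ with $Hv^\top=s^\top$ and $\mathrm{w}(v)\le t$. Moreover, $\mathcal{V}_{\mathbb{F}}(K)=\tau(W)$.
   Context: $\mathbb{F}=\mathbb{F}_2$; vectors are row vectors; $\mathrm{w}$ is the Hamming weight; for an ideal $K$ of $\mathbb{F}[x_1,\dots,x_{N}]$, $\mathcal{V}_{\mathbb{F}}(K)\subseteq\mathbb{F}^{N}$ is the set of common zeros of $K$ in $\mathbb{F}^N$. A system is in standard form if it consists only of: equations of the form $xy+z=0$ ($x,y,z$ distinct variables), no two of which share a variable; and linear equations with at most three variables, of the form $x+\delta=0$, $x+y+\delta=0$ or $x+y+z+\delta=0$ with $\delta\in\mathbb{F}$; and each variable appearing in a linear equation appears in exactly one quadratic equation. Hence with $q$ quadratic equations it has exactly $3q$ variables. Let $\widehat C\subset\mathbb{F}^{10}$ be the code generated by the rows of $$\widehat G=\begin{bmatrix}1&0&0&1&1&0&0&1&1&1\\0&1&0&0&0&1&1&1&1&1\\0&0&1&1&1&1&1&1&1&1\end{bmatrix},$$ $\widehat\epsilon=(0,0,0,0,0,0,0,1,1,1)$,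 $\widehat\Sigma=\widehat\epsilon+\widehat C$, and $\widehat H\in\mathbb{F}^{7\times10}$ a parity-check matrix of $\widehat C$ (full rank, with null space $\widehat C$). Let $\widetilde H\in\mathbb{F}^{7q\times10q}$ be the block-diagonal matrix with $q$ diagonal blocks $\widehat H$, $\widetilde\epsilon=(\widehat\epsilon\|\cdots\|\widehat\epsilon)\in\mathbb{F}^{10q}$ ($q$ copies, $\|$ is concatenation), $\widetilde s^\top=\widetilde H\widetilde\epsilon^\top$, $\widetilde\Sigma=\widehat\Sigma\times\cdots\times\widehat\Sigma$ ($q$ factors), $\widetilde t=3q$, $\widetilde W=\{v\in\widetilde\Sigma\mid \mathrm{w}(v)\le\widetilde t\}$. Let $M_{\tau_3}$ be the $10\times3$ matrix whose top three rows form the identity and whose other rows are zero, $M_\tau\in\mathbb{F}^{10q\times3q}$ the block-diagonal matrix with $q$ blocks $M_{\tau_3}$, and $\tau:\mathbb{F}^{10q}\to\mathbb{F}^{3q}$, $\tau(v)=vM_\tau$ (it keeps the first three entries of each block of length 10). For a linear polynomial $f=\sum_{i=1}^{3q}a_ix_i+\delta$ put $a_f=(a_1,\dots,a_{3q})$ and $\nu(f)=a_fM_\tau^\top\in\mathbb{F}^{10q}$. Given $S$ with linear equations $f_1,\dots,f_\lambda$, let $\delta_i=f_i(0)$, and define $$H=\begin{bmatrix}\widetilde H\\\nu(f_1)\\\vdots\\\nu(f_\lambda)\end{bmatrix}\in\mathbb{F}^{(7q+\lambda)\times10q},\quad s=(\widetilde s\,\|\,\delta_1\|\cdots\|\delta_\lambda),\quad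 t=3q,$$ $$W=\{v\in\widetilde W\mid v\cdot\nu(f_i)^\top=\delta_i\ \text{for all } i=1,\dots,\lambda\}.$$ *)

(* Defs.v *)
From HB Require Import structures.
From mathcomp Require Import all_boot all_order all_algebra.
From mathcomp Require Export mpoly.

Set Implicit Arguments.
Unset Strict Implicit.
Unset Printing Implicit Defensive.

Import GRing.Theory.
Local Open Scope ring_scope.

Notation F := 'F_2.

(* Ideals are represented as Prop-valued predicates. *)

Definition ideal_gen (n : nat) (S : seq {mpoly F[n]}) (p : {mpoly F[n]}) : Prop :=
  exists c : 'I_(size S) -> {mpoly F[n]}, p = \sum_(i < size S) c i * S`_i.

Definition variety (n : nat) (K : {mpoly F[n]} -> Prop) (x : 'rV[F]_n) : Prop :=
  forall p, K p -> p.@[x 0] = 0.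

Definition appears (n : nat) (x : 'I_n) (p : {mpoly F[n]}) : bool :=
  has (fun m : 'X_{1..n} => (0 < m x)%N) (msupp p).

Definition quadratic_eq (n : nat) (p : {mpoly F[n]}) : Prop :=
  exists x y z : 'I_n, uniq [:: x; y; z] /\ p = 'X_x * 'X_y + 'X_z.

Definition linear_eq (n : nat) (p : {mpoly F[n]}) : Prop :=
  exists (xs : seq 'I_n) (delta : F),
    [/\ uniq xs, (1 <= size xs <= 3)%N & p = \sum_(x <- xs) 'X_x + delta%:MP].

Definition standard_form (n q lambda : nat)
    (g : q.-tuple {mpoly F[n]}) (f : lambda.-tuple {mpoly F[n]}) : Prop :=
  [/\ forall i, quadratic_eq (tnth g i),
      forall i j, i != j ->
        forall x, ~~ (appears x (tnth g i) && appears x (tnth g j)),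
      forall l, linear_eq (tnth f l)
    & forall l x, appears x (tnth f l) -> exists! i, appears x (tnth g i)].

Definition wt (n : nat) (v : 'rV[F]_n) : nat := #|[set i | v 0 i != 0]|.

Definition MLD_witnesses (m n : nat) (H : 'M[F]_(m, n)) (s : 'rV[F]_m) (t : nat) :
    {set 'rV[F]_n} :=
  [set v | (H *m v^T == s^T) && (wt v <= t)%N].

(* Positions in a vector of length q * n are split, in row-major order, into a
   block number in 'I_q and an offset in 'I_n. *)

Lemma block_idx_subproof (q n : nat) (i : 'I_q) (a : 'I_n) : (i * n + a < q * n)%N.
Proof.
apply: (@leq_trans (i.+1 * n)); first by rewrite mulSn addnC ltn_add2r.
by rewrite leq_mul2r (ltn_ord i) orbT.
Qed.

Lemma block_no_subproof (q n : nat) (k : 'I_(q * n)) : (k %/ n < q)%N.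
Proof.
case: n k => [|n] k; last by rewrite ltn_divLR.
by case: k => k; rewrite muln0.
Qed.

Lemma block_off_subproof (q n : nat) (k : 'I_(q * n)) : (k %% n < n)%N.
Proof.
case: n k => [|n] k; last by rewrite ltn_mod.
by case: k => k; rewrite muln0.
Qed.

Definition block_idx (q n : nat) (i : 'I_q) (a : 'I_n) : 'I_(q * n) :=
  Ordinal (block_idx_subproof i a).
Definition block_no (q n : nat) (k : 'I_(q * n)) : 'I_q :=
  Ordinal (block_no_subproof k).
Definition block_off (q n : nat) (k : 'I_(q * n)) : 'I_n :=
  Ordinal (block_off_subproof k).

Definition block_diag (q m n : nat) (A : 'M[F]_(m, n)) : 'M[F]_(q * m, q * n) :=
  \matrix_(k, l) if block_no k == block_no l then A (block_off k) (block_off l)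
                 else 0.

Definition repeat_row (q n : nat) (v : 'rV[F]_n) : 'rV[F]_(q * n) :=
  \row_k v 0 (block_off k).

Definition block (q n : nat) (v : 'rV[F]_(q * n)) (i : 'I_q) : 'rV[F]_n :=
  \row_a v 0 (block_idx i a).

Definition Ghat : 'M[F]_(3, 10) :=
  \matrix_(i, j)
    (nth 0%N (nth [::] [:: [:: 1; 0; 0; 1; 1; 0; 0; 1; 1; 1];
                           [:: 0; 1; 0; 0; 0; 1; 1; 1; 1; 1];
                           [:: 0; 0; 1; 1; 1; 1; 1; 1; 1; 1] ]%N i) j)%:R.

Definition Chat : {set 'rV[F]_10} := [set v | (v <= Ghat)%MS].

Definition epshat : 'rV[F]_10 :=
  \row_j (nth 0%N [:: 0; 0; 0; 0; 0; 0; 0; 1; 1; 1]%N j)%:R.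

Definition Sigmahat : {set 'rV[F]_10} := [set epshat + c | c in Chat].

Definition parity_check (m n : nat) (H : 'M[F]_(m, n)) (C : {set 'rV[F]_n}) : Prop :=
  row_free H /\ forall v : 'rV[F]_n, H *m v^T = 0 <-> v \in C.

Definition Htilde (q : nat) (Hhat : 'M[F]_(7, 10)) : 'M[F]_(q * 7, q * 10) :=
  block_diag q Hhat.

Definition epstilde (q : nat) : 'rV[F]_(q * 10) := repeat_row q epshat.

Definition stilde (q : nat) (Hhat : 'M[F]_(7, 10)) : 'rV[F]_(q * 7) :=
  (Htilde q Hhat *m (epstilde q)^T)^T.

Definition Sigmatilde (q : nat) : {set 'rV[F]_(q * 10)} :=
  [set v | [forall i : 'I_q, block v i \in Sigmahat]].

Definition Wtilde (q : nat) : {set 'rV[F]_(q * 10)} :=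
  [set v in Sigmatilde q | (wt v <= 3 * q)%N].

Definition Mtau3 : 'M[F]_(10, 3) := pid_mx 3.
Definition Mtau (q : nat) : 'M[F]_(q * 10, q * 3) := block_diag q Mtau3.

Definition tau (q : nat) (v : 'rV[F]_(q * 10)) : 'rV[F]_(q * 3) := v *m Mtau q.

Definition lin_coefs (n : nat) (f : {mpoly F[n]}) : 'rV[F]_n := \row_i f@_U_(i).

Definition nu (q : nat) (f : {mpoly F[q * 3]}) : 'rV[F]_(q * 10) :=
  lin_coefs f *m (Mtau q)^T.

Definition const_term (n : nat) (f : {mpoly F[n]}) : F := f.@[fun=> 0].

Section Instance.
Variables (q lambda : nat) (Hhat : 'M[F]_(7, 10)).
Variable f : lambda.-tuple {mpoly F[q * 3]}.

Definition mldH : 'M[F]_(q * 7 + lambda, q * 10) :=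
  col_mx (Htilde q Hhat) (\matrix_(i < lambda) nu (tnth f i)).

Definition mlds : 'rV[F]_(q * 7 + lambda) :=
  row_mx (stilde q Hhat) (\row_(i < lambda) const_term (tnth f i)).

Definition mldt : nat := (3 * q)%N.

Definition W : {set 'rV[F]_(q * 10)} :=
  [set v in Wtilde q |
    [forall i : 'I_lambda, v *m (nu (tnth f i))^T == (const_term (tnth f i))%:M]].

End Instance.
Arguments mldt q : clear implicits.

(* Main.v *)
(** The word [epshat + (x,y,z) *m Ghat] has weight at least 3, with equality
    exactly when [xy + z = 0]. An element of [Sigmatilde q] is determined by its
    image under [tau], and since each of its [q] blocks weighs at least 3, the
    bound [3q] on the total weight forces equality in every block, i.e. all [q]
    quadratic equations. The rows [nu (f_i)] of the parity-check matrix are the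
    linear equations pulled back along [tau]. *)

Require Import Defs.
From HB Require Import structures.
From mathcomp Require Import all_boot all_order all_algebra.

Set Implicit Arguments.
Unset Strict Implicit.
Unset Printing Implicit Defensive.

Import GRing.Theory.
Local Open Scope ring_scope.

(** * Block decomposition of indices, sums, products and weights *)

Lemma block_no_idx (q n : nat) (i : 'I_q) (a : 'I_n) : block_no (block_idx i a) = i.
Proof.
apply: val_inj; rewrite /= divnMDl ?(leq_ltn_trans _ (ltn_ord a)) //.
by rewrite divn_small ?addn0.
Qed.

Lemma block_off_idx (q n : nat) (i : 'I_q) (a : 'I_n) : block_off (block_idx i a) = a.
Proof. by apply: val_inj; rewrite /= modnMDl modn_small. Qed.

Lemma block_idxK (q n : nat) (k : 'I_(q * n)) :
  block_idx (block_no k) (block_off k) = k.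
Proof. by apply: val_inj; rewrite /= -divn_eq. Qed.

Lemma sum_block (V : nmodType) (q n : nat) (G : 'I_(q * n) -> V) :
  \sum_k G k = \sum_(i < q) \sum_(a < n) G (block_idx i a).
Proof.
rewrite pair_big /= (reindex (fun p : 'I_q * 'I_n => block_idx p.1 p.2)) //.
exists (fun k => (block_no k, block_off k)) => [[i a] _|k _] /=.
  by rewrite block_no_idx block_off_idx.
exact: block_idxK.
Qed.

Lemma block_inj (q n : nat) (v w : 'rV[F]_(q * n)) :
  (forall i, block v i = block w i) -> v = w.
Proof.
move=> vw; apply/rowP=> k; rewrite -(block_idxK k).
by have /rowP/(_ (block_off k)) := vw (block_no k); rewrite !mxE.
Qed.

Lemma block_repeat_row (q n : nat) (v : 'rV[F]_n) (i : 'I_q) :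
  block (repeat_row q v) i = v.
Proof. by apply/rowP=> a; rewrite !mxE block_off_idx. Qed.

Lemma block_mul_diag (q m n : nat) (A : 'M[F]_(m, n)) (v : 'rV[F]_(q * m)) i :
  block (v *m block_diag q A) i = block v i *m A.
Proof.
apply/rowP=> a; rewrite !mxE sum_block (bigD1 i) //= [X in _ + X]big1 ?addr0.
  by apply: eq_bigr => b _; rewrite !mxE !block_no_idx !block_off_idx eqxx.
move=> j ji; apply: big1 => b _.
by rewrite !mxE !block_no_idx (negPf ji) mulr0.
Qed.

Lemma trmx_block_diag (q m n : nat) (A : 'M[F]_(m, n)) :
  (block_diag q A)^T = block_diag q A^T.
Proof. by apply/matrixP=> k l; rewrite !mxE eq_sym. Qed.

Lemma wtE (n : nat) (v : 'rV[F]_n) : wt v = (\sum_j (v 0%R j != 0%R))%N.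
Proof. by rewrite /wt -sum1dep_card big_mkcond; apply: eq_bigr => j _; case: (_ != _). Qed.

Lemma wt_block (q n : nat) (v : 'rV[F]_(q * n)) :
  wt v = (\sum_(i < q) wt (block v i))%N.
Proof.
rewrite wtE sum_block; apply: eq_bigr => i _; rewrite wtE.
by apply: eq_bigr => a _; rewrite mxE.
Qed.

(** * The coset of a single block and its weights *)

Lemma SigmahatP (v : 'rV[F]_10) :
  reflect (exists u : 'rV[F]_3, v = epshat + u *m Ghat) (v \in Sigmahat).
Proof.
apply: (iffP imsetP) => [[c]|[u ->]].
  by rewrite inE => /submxP[u ->] ->; exists u.
by exists (u *m Ghat); rewrite // inE submxMl.
Qed.

Lemma epshat_Mtau3 : epshat *m Mtau3 = 0.
Proof.
apply/rowP=> j; rewrite !mxE; do 10! rewrite big_ord_recr /=; rewrite big_ord0 !mxE.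
by apply/eqP; case: j => [[|[|[|]]]].
Qed.

Lemma Ghat_Mtau3 : Ghat *m Mtau3 = 1%:M.
Proof.
apply/matrixP=> i j; rewrite !mxE; do 10! rewrite big_ord_recr /=; rewrite big_ord0 !mxE.
by apply/eqP; case: i => [[|[|[|]]]] // ?; case: j => [[|[|[|]]]].
Qed.

(** [Ghat] is systematic and [epshat] vanishes on the first three positions, so these positions
    carry the message [u] itself. *)
Lemma coset_Mtau3 (u : 'rV[F]_3) : (epshat + u *m Ghat) *m Mtau3 = u.
Proof. by rewrite mulmxDl epshat_Mtau3 add0r -mulmxA Ghat_Mtau3 mulmx1. Qed.

(** For [u = (x,y,z)] the word consists of [x], [y], [z], twice [x+z], twice [y+z] and three times
    [x+y+z+1]. Its weight is 3 at 000, 100, 010 and 111, and 5, 7 or 9 at the other four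
    messages. *)
Lemma wt_coset (u : 'rV[F]_3) :
  (3 <= wt (epshat + u *m Ghat)%R
     ?= iff (u 0 (inord 0) * u 0 (inord 1) + u 0 (inord 2) == 0)%R)%N.
Proof.
(* The indices are put in the form produced by [big_ord_recl], so that both sides mention the same
   three entries of [u], which are then enumerated. *)
have e0 : inord 0 = ord0 :> 'I_3 by apply: val_inj; rewrite /= inordK.
have e1 : inord 1 = lift ord0 ord0 :> 'I_3 by apply: val_inj; rewrite /= inordK.
have e2 : inord 2 = lift ord0 (lift ord0 ord0) :> 'I_3
  by apply: val_inj; rewrite /= inordK.
rewrite wtE e0 e1 e2.
under eq_bigr do rewrite !mxE !big_ord_recl big_ord0 !mxE.
rewrite !big_ord_recl big_ord0.
move: (u 0 _) (u 0 _) (u 0 _).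
by case=> [[|[|]]] // ? [[|[|]]] // ? [[|[|]]].
Qed.

(** The sum is at least [c * q], so the upper bound forces equality, and hence equality in every
    term. *)
Lemma leif_sum_const (q c : nat) (w : 'I_q -> nat) (P : pred 'I_q) :
  (forall i, c <= w i ?= iff P i)%N ->
  (\sum_i w i <= c * q)%N = [forall i, P i].
Proof.
move=> wP.
have [le eq] := leqif_sum (fun i (_ : true) => wP i).
move: le eq; rewrite sum_nat_const card_ord mulnC => le <-.
by rewrite eqn_leq le.
Qed.

(** * Evaluation of linear equations and zeros of ideals *)

Lemma meval_linear_eq (n : nat) (p : {mpoly F[n]}) (x : 'I_n -> F) :
  linear_eq p -> p.@[x] = \sum_i p@_U_(i) * x i + const_term p.
Proof.
case=> xs [d [_ _ ->]]; rewrite /const_term !mevalD !mevalC !raddf_sum /=.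
under eq_bigr do rewrite mevalXU.
rewrite [X in _ = _ + (X + _)]big1 => [|i _]; last by rewrite mevalXU.
rewrite add0r; congr (_ + _).
under [RHS]eq_bigr => i _.
  rewrite mcoeffD mcoeffC mnm1_eq0 mulr0 addr0 raddf_sum /= mulr_suml.
  under eq_bigr do rewrite mcoeffXU.
  over.
(* After the exchange, each variable [y] of the equation meets only the index [i = y]. *)
rewrite exchange_big /=; apply: eq_bigr => y _.
rewrite (bigD1 y) //= eqxx mul1r big1 ?addr0 // => i iy.
by rewrite eq_sym (negPf iy) mul0r.
Qed.

Lemma variety_ideal_gen (n : nat) (S : seq {mpoly F[n]}) (x : 'rV[F]_n) :
  variety (ideal_gen S) x <-> forall p, p \in S -> p.@[x 0] = 0.
Proof.
split=> [Vx p pS|Sx _ [c ->]].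
  have lt_p : (index p S < size S)%N by rewrite index_mem.
  (* A generator lies in the ideal: coefficient 1 at its first occurrence and 0 elsewhere, so
     repetitions in [S] do no harm. *)
  apply: Vx; exists (fun i => (i == Ordinal lt_p)%:R).
  rewrite (bigD1 (Ordinal lt_p)) //= eqxx mul1r nth_index // big1 ?addr0 //.
  by move=> i /negPf->; rewrite mul0r.
rewrite raddf_sum big1 // => i _; rewrite /= mevalM (Sx S`_i) ?mulr0 //.
exact: mem_nth.
Qed.

(** Moving [Mtau] from [nu p] onto [v] turns the product into the linear part of [p] at [tau v]; in
    characteristic 2 the sign of the constant disappears. *)
Lemma meval_linear_eq0 (q : nat) (p : {mpoly F[q * 3]}) (v : 'rV[F]_(q * 10)) :
  linear_eq p ->
  (p.@[tau v 0] == 0) = (v *m (nu p)^T == (const_term p)%:M).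
Proof.
move=> lin_p; rewrite (meval_linear_eq _ lin_p) addr_eq0 oppr_pchar2 ?pchar_Fp //.
rewrite /nu trmx_mul trmxK mulmxA -/(tau v).
have -> : \sum_i p@_U_(i) * tau v 0 i = (tau v *m (lin_coefs p)^T) 0 0.
  by rewrite mxE; apply: eq_bigr => i _; rewrite !mxE mulrC.
apply/eqP/eqP => [e|->]; last by rewrite mxE eqxx.
by apply/rowP=> j; rewrite (ord1 j) e mxE eqxx.
Qed.

(** * The product coset, its syndrome and its weight bound *)

Lemma block_tau (q : nat) (v : 'rV[F]_(q * 10)) i :
  block (tau v) i = block v i *m Mtau3.
Proof. exact: block_mul_diag. Qed.

Lemma Sigmatilde_syndrome (q : nat) (Hhat : 'M[F]_(7, 10)) (v : 'rV[F]_(q * 10)) :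
  parity_check Hhat Chat ->
  (Htilde q Hhat *m v^T == (stilde q Hhat)^T) = (v \in Sigmatilde q).
Proof.
(* Transposing gives products of row vectors, which can be compared block by block:
   [block v i - epshat] must lie in the null space [Chat] of [Hhat]. *)
case=> _ HhatP; rewrite /stilde trmxK -(inj_eq trmx_inj) !trmx_mul !trmxK.
rewrite /Htilde trmx_block_diag inE; apply/eqP/forallP => [e i|vS].
  apply/imsetP; exists (block v i - epshat); last by rewrite addrC subrK.
  apply/HhatP/trmx_inj; rewrite trmx_mul trmxK trmx0 mulmxBl.
  by rewrite -block_mul_diag e block_mul_diag block_repeat_row subrr.
apply: block_inj => i; rewrite !block_mul_diag block_repeat_row.
have /imsetP[c cC ->] := vS i.
have cH0 : c *m Hhat^T = 0 by rewrite -[c]trmxK -trmx_mul (HhatP c).2 // trmx0.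
by rewrite mulmxDl cH0 addr0.
Qed.

Lemma W_witnesses (q lambda : nat) (Hhat : 'M[F]_(7, 10))
    (f : lambda.-tuple {mpoly F[q * 3]}) :
  parity_check Hhat Chat ->
  W f = MLD_witnesses (mldH Hhat f) (mlds Hhat f) (mldt q).
Proof.
move=> HhatP; apply/setP=> v.
rewrite [LHS]in_set [v \in Wtilde q]in_set -(Sigmatilde_syndrome v HhatP).
(* Both sides now ask for the syndrome, the linear checks and the weight bound; [andbAC] aligns
   their order. *)
rewrite [RHS]in_set mul_col_mx tr_row_mx andbAC.
congr (_ && _).
have -> (A B : 'cV[F]_(q * 7)) (C D : 'cV[F]_lambda) :
    (col_mx A C == col_mx B D) = (A == B) && (C == D).
  by apply/eqP/andP => [/eq_col_mx[-> ->]|[/eqP-> /eqP->]].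
congr (_ && _).
have entry i : (v *m (nu (tnth f i))^T) 0 0 =
    ((\matrix_(j < lambda) nu (tnth f j)) *m v^T) i 0.
  by rewrite !mxE; apply: eq_bigr => k _; rewrite !mxE mulrC.
apply/forallP/eqP => [e|e i].
  by apply/colP=> i; rewrite -entry (eqP (e i)) !mxE eqxx.
by apply/eqP/rowP=> j; rewrite (ord1 j) entry e !mxE eqxx.
Qed.

Lemma Sigmatilde_block (q : nat) (v : 'rV[F]_(q * 10)) i :
  v \in Sigmatilde q -> block v i = epshat + block (tau v) i *m Ghat.
Proof.
rewrite inE => /forallP/(_ i)/SigmahatP[u vi].
by rewrite block_tau vi coset_Mtau3.
Qed.

Lemma Sigmatilde_lift (q : nat) (x : 'rV[F]_(q * 3)) :
  exists2 v, v \in Sigmatilde q & tau v = x.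
Proof.
(* Each block of [x] is encoded as a message in the coset. *)
pose v : 'rV[F]_(q * 10) :=
  \row_k (epshat + block x (block_no k) *m Ghat) 0 (block_off k).
have vE i : block v i = epshat + block x i *m Ghat.
  by apply/rowP=> a; rewrite 2![LHS]mxE block_no_idx block_off_idx.
exists v; last by apply: block_inj => i; rewrite block_tau vE coset_Mtau3.
by rewrite inE; apply/forallP=> i; apply/SigmahatP; exists (block x i).
Qed.

Lemma wt_Sigmatilde (q : nat) (v : 'rV[F]_(q * 10)) :
  v \in Sigmatilde q ->
  (wt v <= 3 * q)%N =
  [forall i : 'I_q, tau v 0 (block_idx i (inord 0)) * tau v 0 (block_idx i (inord 1))
                    + tau v 0 (block_idx i (inord 2)) == 0].
Proof.
move=> vS; rewrite wt_block; apply: leif_sum_const => i.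
rewrite (Sigmatilde_block _ vS).
by have := wt_coset (block (tau v) i); rewrite !mxE.
Qed.

Theorem theorem4p15 (q lambda : nat) (q_gt0 : (0 < q)%N)
    (Hhat : 'M[F]_(7, 10)) (Hhat_parity : parity_check Hhat Chat)
    (g : q.-tuple {mpoly F[q * 3]}) (f : lambda.-tuple {mpoly F[q * 3]})
    (S_standard : standard_form g f)
    (S_ordered : forall i : 'I_q,
       tnth g i = 'X_(block_idx i (inord 0)) * 'X_(block_idx i (inord 1))
                  + 'X_(block_idx i (inord 2))) :
  W f = MLD_witnesses (mldH Hhat f) (mlds Hhat f) (mldt q) /\
  (forall x : 'rV[F]_(q * 3),
     variety (ideal_gen (g ++ f)) x <-> x \in [set tau v | v in W f]).
Proof.
split; first exact: W_witnesses.
have lin_f l : linear_eq (tnth f l) by case: S_standard.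
(* Within the product coset, the weight bound expresses the quadratic equations at [tau v] and the
   extra checks the linear ones. *)
have WP v : v \in Sigmatilde q ->
    v \in W f <-> variety (ideal_gen (g ++ f)) (tau v).
  move=> vS; rewrite variety_ideal_gen in_set [v \in Wtilde q]in_set vS wt_Sigmatilde //=.
  split=> [/andP[/forallP gv /forallP fv] p|V].
    rewrite mem_cat => /orP[] /tnthP[i ->]; apply/eqP; last first.
      by rewrite (meval_linear_eq0 _ (lin_f i)).
    by rewrite S_ordered mevalD mevalM !mevalXU.
  apply/andP; split; apply/forallP=> i; last first.
    by rewrite -(meval_linear_eq0 _ (lin_f i)) V // mem_cat mem_tnth orbT.
  have /V/eqP : tnth g i \in g ++ f by rewrite mem_cat mem_tnth.
  by rewrite S_ordered mevalD mevalM !mevalXU.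
move=> x; split=> [Vx|/imsetP[v vW ->]].
  (* A zero of the ideal is lifted to the coset word encoding it, which [WP] then places in
     [W f]. *)
  have [v vS vx] := Sigmatilde_lift x.
  by apply/imsetP; exists v => //; apply/WP; rewrite // vx.
by apply/WP => //; move: vW; rewrite !inE => /andP[/andP[]].
Qed.
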